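(* Flutter (as defined in the context) satisfies Validity: in every execution, all messages broadcast by a correct client are eventually delivered by a correct server, i.e. if a correct client $\theta$ triggers $\langle tob.\mathrm{Broadcast}\mid m\rangle$ for some $m\in\mathcal M$, then some correct server eventually triggers $\langle tob.\mathrm{Deliver}\mid\theta,m\rangle$.
   Context: **Model.** $f\ge 0$ is an integer; $\Pi$ is a fixed, commonly known set of $n=5f+1$ servers, of which at most $f$ are faulty (Byzantine: may behave arbitrarily and collude); $\Theta$ is a set of clients (possibly overlapping with $\Pi$), any number of which may be faulty; $\mathcal M$ is the set of messages; $\mathbb T$ denotes times (real numbers). Correct processes follow the algorithm. Any two processes (including a process and itself) communicate via reliable, authenticated, FIFO links. Partial synchrony: message delays are bounded by an unknown constant $\Delta$ (which includes constant-time local computation for producing and processing a message), and the difference between real time and the local time of any process is bounded by an unknown constant $\Psi$. Local clocks are non-decreasing; $local\_time()$ reads the local clock. Event handlers execute atomically, and a process delivers only finitely many messages in finite time. Correct clients never broadcast the same message twice. **Representative Binary Consensus** (instance $con$): every correct server proposes one value of $\mathbb B=\{\mathtt{True},\mathtt{False}\}$ via $\langle con.\mathrm{Propose}\mid p\rangle$, and may trigger $\langle con.\mathrm{Decide}\mid d\rangle$. Integrity: no correct server decides more than once. Agreement: no two correct servers decide different values. Termination: if every correct server proposes, every correct server eventually decides. Representative Validity: a decided value was proposed by at least $f+1$ correct servers. **Order.** Fix total orders on $\Theta$ and $\mathcal M$; $\Theta\times\mathcal M\times\mathbb T$ is totally ordered by comparing first the time component, then the client, then the message. The initial value $(\bot,\bot,-\infty)$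 is below every element. **Flutter, server algorithm.** There is one independent Representative Binary Consensus instance $con[(\theta,m,b)]$ for every $(\theta,m,b)\in\Theta\times\mathcal M\times\mathbb T$. Each server keeps sets $observed,proposed,candidates\subseteq\Theta\times\mathcal M\times\mathbb T$ and $delivered\subseteq\Theta\times\mathcal M$ (all initially empty), a map $remote\_times:\Pi\to\mathbb T\cup\{-\infty\}$ (initially constantly $-\infty$), a map $decisions$ from $\Theta\times\mathcal M\times\mathbb T$ to $\mathbb B$ (initially empty), and $last\_processed$ (initially $(\bot,\bot,-\infty)$). - $beat()$: send $[\mathtt{Time},local\_time()]$ to every server. - Upon delivering $[\mathtt{Time},t]$ from $\pi$: $remote\_times[\pi]=\max(remote\_times[\pi],t)$. - $lock\_time()$: return the maximum $t$ such that $|\{\pi: remote\_times[\pi]\ge t\}|\ge 4f+1$. - $spot(\theta,m,b)$: if $b>lock\_time()$, add $(\theta,m,b)$ to $candidates$. Then, if $(\theta,m,b)\notin observed$: send $[\mathtt{Observe},\theta,m,b]$ to every server, schedule $beat()$ for execution at local time $b$ (immediately if $b$ has already passed), and add $(\theta,m,b)$ to $observed$. - Upon delivering $[\mathtt{Observe},\theta,m,b]$ from a server: $spot(\theta,m,b)$. - Upon delivering $[\mathtt{Message},m,b]$ from a client $\theta$: $spot(\theta,m,b)$; then, if $(\theta,m,b)\notin proposed$: trigger $\langle con[(\theta,m,b)].\mathrm{Propose}\mid (b>local\_time())\rangle$ (the truth value of the inequality) and add $(\theta,m,b)$ to $proposed$. - Upon existence of $(\theta,m,b)\in observed\setminus proposed$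 with $b\le local\_time()$: trigger $\langle con[(\theta,m,b)].\mathrm{Propose}\mid\mathtt{False}\rangle$ and add $(\theta,m,b)$ to $proposed$. - Upon $\langle con[(\theta,m,b)].\mathrm{Decide}\mid v\rangle$: send $[\mathtt{Decision},m,b,v]$ to $\theta$ and set $decisions[(\theta,m,b)]=v$. - Whenever the minimum $(\theta,m,b)$ among the elements of $candidates$ that are $>last\_processed$ exists, is a key of $decisions$, and satisfies $b\le lock\_time()$: if $decisions[(\theta,m,b)]=\mathtt{True}$, call $order(\theta,m,b)$; then set $last\_processed=(\theta,m,b)$. - $order(\theta,m,b)$: if $(\theta,m)\notin delivered$, trigger $\langle tob.\mathrm{Deliver}\mid\theta,m\rangle$ and add $(\theta,m)$ to $delivered$. **Flutter, client algorithm.** Parameters: message-delay estimate $\tilde\Delta>0$ (otherwise arbitrary) and a constant margin $\epsilon>0$. Each client keeps maps $submissions$ from $\mathcal M$ to $\mathbb N\times\mathbb T$ and $decisions$ from $\mathcal M\times\mathbb T\times\Pi$ to $\mathbb B$ (initially empty). - $submit(m,r)$: let $b=local\_time()+2^r\tilde\Delta+\epsilon$; send $[\mathtt{Message},m,b]$ to every server; set $submissions[m]=(r,b)$. - Upon $\langle tob.\mathrm{Broadcast}\mid m\rangle$: $submit(m,0)$. - Upon delivering $[\mathtt{Decision},m,b,v]$ from server $\pi$: $decisions[(m,b,\pi)]=v$. - Upon existence of $m$ with $submissions[m]=(r,b)$ and $|\{\pi: decisions[(m,b,\pi)]=\mathtt{False}\}|\ge f+1$: $submit(m,r+1)$. 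*)

(* Defs.v *)
From HB Require Import structures.
From mathcomp Require Import all_boot all_order all_algebra.
From mathcomp Require Import finmap.
From mathcomp Require Import all_classical all_reals ereal.

Set Implicit Arguments.
Unset Strict Implicit.
Unset Printing Implicit Defensive.

Import Order.TTheory GRing.Theory Num.Theory.
Local Open Scope ring_scope.

(* The static data: servers and clients are two roles that processes may play.
   [srv] and [cli] are injective but their ranges may meet, so that a process
   can be a server and a client at once. *)
Record system (R : realType) := System {
  faults : nat;
  Proc : eqType;
  Server : finType;
  client_disp : Order.disp_t;
  Client : orderType client_disp;
  msg_disp : Order.disp_t;
  Msg : orderType msg_disp;
  srv : Server -> Proc;
  cli : Client -> Proc;
  srv_inj : injective srv;
  cli_inj : injective cli;
  card_server : #|{: Server}| = (5 * faults + 1)%N;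
  delay_estimate : R;
  delay_estimate_gt0 : 0 < delay_estimate;
  margin : R;
  margin_gt0 : 0 < margin
}.

Section Algorithm.
Context {R : realType} (S : system R).

Local Notation Proc := (Proc S).
Local Notation Server := (Server S).
Local Notation Client := (Client S).
Local Notation Msg := (Msg S).
Local Notation f := (faults S).

Definition server_of (p : Proc) : option Server := [pick pi | srv pi == p].

Definition client_of (p : Proc) : option Client :=
  match pselect (exists c : Client, cli c = p) with
  | left h => Some (sval (cid h))
  | right _ => None
  end.

Definition is_server (p : Proc) : Prop := exists pi : Server, srv pi = p.
Definition is_client (p : Proc) : Prop := exists c : Client, cli c = p.

(* The triple (c, m, b) is stored as (b, c, m): the lexicographic product [*l]
   then carries the required total order (time, then client, then message). *)
Notation stamp := (R *l Client *l Msg)%type.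
Definition mk_stamp (c : Client) (m : Msg) (b : R) : stamp := (b, c, m).
Definition s_time (x : stamp) : R := x.1.1.
Definition s_client (x : stamp) : Client := x.1.2.
Definition s_msg (x : stamp) : Msg := x.2.

Inductive packet :=
| PTime of R
| PObserve of stamp
| PMessage of Msg & R
| PDecision of Msg & R & bool.

HB.instance Definition _ := gen_eqMixin packet.

(* Everything a handler emits, in program order. *)
Inductive output :=
| Send of Proc & packet
| Propose of stamp & bool
| TobDeliver of Client & Msg.

HB.instance Definition _ := gen_eqMixin output.

(* One event is one atomic handler activation; [Idle] is a stuttering step. *)
Inductive event :=
| Idle
| Receive of Proc & packet
| Decide of stamp & bool
| TobBroadcast of Msg
| Beat of R
| ProposeLate of stamp
| Process of stamp
| Resubmit of Msg.

Record server_state := ServerState {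
  observed : {fset stamp};
  proposed : {fset stamp};
  candidates : {fset stamp};
  delivered : {fset Client * Msg};
  remote_times : Server -> \bar R;
  decisions : {fmap stamp -> bool};
  last_processed : option stamp; (* [None] is (bot, bot, -oo) *)
  scheduled : seq R (* local times of the pending beats, with multiplicity *)
}.

Record client_state := ClientState {
  submissions : {fmap Msg -> nat * R};
  reports : {fmap Msg * R * Server -> bool} (* the client's [decisions] map *)
}.

Definition init_server : server_state :=
  ServerState fset0 fset0 fset0 fset0 (fun=> -oo%E) fmap0 None [::].

Definition init_client : client_state := ClientState fmap0 fmap0.

Definition set_observed A st := ServerState A (proposed st) (candidates st)
  (delivered st) (remote_times st) (decisions st) (last_processed st)
  (scheduled st).
Definition set_proposed A st := ServerState (observed st) A (candidates st)
  (delivered st) (remote_times st) (decisions st) (last_processed st)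
  (scheduled st).
Definition set_candidates A st := ServerState (observed st) (proposed st) A
  (delivered st) (remote_times st) (decisions st) (last_processed st)
  (scheduled st).
Definition set_delivered A st := ServerState (observed st) (proposed st)
  (candidates st) A (remote_times st) (decisions st) (last_processed st)
  (scheduled st).
Definition set_remote_times A st := ServerState (observed st) (proposed st)
  (candidates st) (delivered st) A (decisions st) (last_processed st)
  (scheduled st).
Definition set_decisions A st := ServerState (observed st) (proposed st)
  (candidates st) (delivered st) (remote_times st) A (last_processed st)
  (scheduled st).
Definition set_last_processed A st := ServerState (observed st) (proposed st)
  (candidates st) (delivered st) (remote_times st) (decisions st) A
  (scheduled st).
Definition set_scheduled A st := ServerState (observed st) (proposed st)
  (candidates st) (delivered st) (remote_times st) (decisions st)
  (last_processed st) A.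

Definition to_servers (w : packet) : seq output :=
  [seq Send (srv pi) w | pi <- enum Server].

Definition beat (now : R) : seq output := to_servers (PTime now).

Definition lock_set (st : server_state) : set (\bar R) :=
  [set t | (4 * f + 1 <= #|[pred pi | (t <= remote_times st pi)%E]|)%N]%classic.

Definition lock_time (st : server_state) : \bar R := ereal_sup (lock_set st).

(* The supremum is attained, i.e. [lock_time] is a maximum. *)
Lemma lock_time_max (st : server_state) :
  lock_set st (lock_time st) /\
  (forall t, lock_set st t -> (t <= lock_time st)%E).
Proof.
split; last by move=> t /ereal_sup_ubound.
pose F := remote_times st.
have sub t u : (t <= u)%E -> lock_set st u -> lock_set st t.
  move=> tu; rewrite /lock_set /= => /leq_trans; apply.
  by apply/subset_leq_card/fintype.subsetP => pi; rewrite !inE; apply: le_trans.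
have down t : lock_set st t -> exists2 pi, lock_set st (F pi) & (t <= F pi)%E.
  move=> At; have /card_gt0P[pi0 pi0B] : (0 < #|[pred pi | (t <= F pi)%E]|)%N.
    by apply: leq_trans At; rewrite addn1.
  case: (arg_minP F pi0B) => pi piB pimin; exists pi => //.
  apply: leq_trans At _; apply/subset_leq_card/fintype.subsetP => pi'.
  by rewrite !inE => /pimin.
have Aoo : lock_set st -oo%E.
  rewrite /lock_set /=; rewrite (eq_card (B := {: Server})).
    by rewrite card_server leq_add2r leq_mul2r orbT.
  by move=> pi; rewrite !inE leNye.
have [pi0 Api0 _] := down _ Aoo.
have Bpi0 : [pred pi | `[< lock_set st (F pi) >]] pi0 by exact/asboolP.
case: (arg_maxP F Bpi0) => pi /asboolP Api pimax.
suff -> : lock_time st = F pi by [].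
apply/eqP; rewrite eq_le; apply/andP; split; last exact: ereal_sup_ubound.
apply: ge_ereal_sup => t /down[pi' Api' /le_trans]; apply.
exact/pimax/asboolP.
Qed.

Definition spot (now : R) (x : stamp) (st : server_state) :
    server_state * seq output :=
  let st1 := if (lock_time st < (s_time x)%:E)%E
             then set_candidates (x |` candidates st)%fset st else st in
  if x \in observed st1 then (st1, [::]) else
  let st2 := set_observed (x |` observed st1)%fset st1 in
  if s_time x <= now then (st2, to_servers (PObserve x) ++ beat now)
  else (set_scheduled (s_time x :: scheduled st2) st2,
        to_servers (PObserve x)).

Definition propose (x : stamp) (v : bool) (st : server_state) :
    server_state * seq output :=
  (set_proposed (x |` proposed st)%fset st, [:: Propose x v]).

Definition on_message (now : R) (x : stamp) (st : server_state) :
    server_state * seq output :=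
  let: (st1, o1) := spot now x st in
  if x \in proposed st1 then (st1, o1) else
  let: (st2, o2) := propose x (now < s_time x) st1 in (st2, o1 ++ o2).

Definition on_time (pi : Server) (t : R) (st : server_state) : server_state :=
  set_remote_times
    (fun pi' => if pi' == pi then Order.max (remote_times st pi) t%:E
                else remote_times st pi') st.

Definition order_msg (x : stamp) (st : server_state) :
    server_state * seq output :=
  let cm := (s_client x, s_msg x) in
  if cm \in delivered st then (st, [::])
  else (set_delivered (cm |` delivered st)%fset st, [:: TobDeliver cm.1 cm.2]).

Definition process (x : stamp) (st : server_state) :
    server_state * seq output :=
  let: (st1, o) :=
    if (decisions st).[? x]%fmap == Some true then order_msg x st
    else (st, [::]) in
  (set_last_processed (Some x) st1, o).

Definition on_decide (x : stamp) (v : bool) (st : server_state) :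
    server_state * seq output :=
  (set_decisions (decisions st).[x <- v]%fmap st,
   [:: Send (cli (s_client x)) (PDecision (s_msg x) (s_time x) v)]).

Definition submit (now : R) (m : Msg) (r : nat) (st : client_state) :
    client_state * seq output :=
  let b := now + 2 ^+ r * delay_estimate S + margin S in
  (ClientState (submissions st).[m <- (r, b)]%fmap (reports st),
   to_servers (PMessage m b)).

Definition on_report (pi : Server) (m : Msg) (b : R) (v : bool)
    (st : client_state) : client_state :=
  ClientState (submissions st) (reports st).[(m, b, pi) <- v]%fmap.

Definition rejected (st : client_state) (m : Msg) (b : R) : bool :=
  (f + 1 <= #|[pred pi : Server |
     (reports st).[? (m, b, pi)]%fmap == Some false]|)%N.

Definition after_last (st : server_state) (x : stamp) : bool :=
  if last_processed st is Some y then (y < x)%O else true.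

Definition is_next (st : server_state) (x : stamp) : Prop :=
  [/\ x \in candidates st, after_last st x &
      forall y, y \in candidates st -> after_last st y -> (x <= y)%O].

Definition pstate := (server_state * client_state)%type.
Definition init : pstate := (init_server, init_client).

Definition guard (p : Proc) (now : R) (st : pstate) (e : event) : Prop :=
  match e with
  | Idle => True
  | Receive _ _ => True
  | Decide _ _ => is_server p
  | TobBroadcast _ => is_client p
  | Beat b => [/\ is_server p, b \in scheduled st.1 & b <= now]
  | ProposeLate x =>
      [/\ is_server p, x \in observed st.1, x \notin proposed st.1
        & s_time x <= now]
  | Process x =>
      [/\ is_server p, is_next st.1 x, x \in decisions st.1
        & ((s_time x)%:E <= lock_time st.1)%E]
  | Resubmit m =>
      is_client p /\
      exists r b, (submissions st.2).[? m]%fmap = Some (r, b) /\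
                  rejected st.2 m b
  end.

Definition on_server (st : pstate) (a : server_state * seq output) :
  pstate * seq output := ((a.1, st.2), a.2).

Definition on_client (st : pstate) (a : client_state * seq output) :
  pstate * seq output := ((st.1, a.1), a.2).

(* A packet is ignored unless sender and receiver have the roles it is meant
   for. *)
Definition receive (p : Proc) (now : R) (q : Proc) (w : packet) (st : pstate) :
    pstate * seq output :=
  match w with
  | PTime t =>
      match server_of p, server_of q with
      | Some _, Some pi => on_server st (on_time pi t st.1, [::])
      | _, _ => (st, [::])
      end
  | PObserve x =>
      match server_of p, server_of q with
      | Some _, Some _ => on_server st (spot now x st.1)
      | _, _ => (st, [::])
      end
  | PMessage m b =>
      match server_of p, client_of q with
      | Some _, Some c => on_server st (on_message now (mk_stamp c m b) st.1)
      | _, _ => (st, [::])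
      end
  | PDecision m b v =>
      match client_of p, server_of q with
      | Some _, Some pi => on_client st (on_report pi m b v st.2, [::])
      | _, _ => (st, [::])
      end
  end.

Definition effect (p : Proc) (now : R) (e : event) (st : pstate) :
    pstate * seq output :=
  match e with
  | Idle => (st, [::])
  | Receive q w => receive p now q w st
  | Decide x v => on_server st (on_decide x v st.1)
  | TobBroadcast m => on_client st (submit now m 0 st.2)
  | Beat b =>
      on_server st (set_scheduled (rem b (scheduled st.1)) st.1, beat now)
  | ProposeLate x => on_server st (propose x false st.1)
  | Process x => on_server st (process x st.1)
  | Resubmit m =>
      if (submissions st.2).[? m]%fmap is Some rb
      then on_client st (submit now m rb.1.+1 st.2) else (st, [::])
  end.

(* The events that the process itself must eventually trigger. *)
Definition internal (e : event) : bool :=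
  match e with
  | Beat _ | ProposeLate _ | Process _ | Resubmit _ => true
  | _ => false
  end.

(* Each process runs its own sequence of atomic steps, placed on the real time
   line. Nothing is recorded for faulty processes beyond the packets that the
   correct ones receive from them: their components below are meaningless and
   never constrained. *)
Record execution := Execution {
  correct : pred Proc;
  clock : Proc -> R -> R;
  step_time : Proc -> nat -> R;
  step_event : Proc -> nat -> event
}.

Section Execution.
Variable E : execution.

Definition local_time (p : Proc) (i : nat) : R := clock E p (step_time E p i).

Fixpoint state (p : Proc) (i : nat) : pstate :=
  if i is k.+1
  then (effect p (local_time p k) (step_event E p k) (state p k)).1
  else init.

Definition outputs (p : Proc) (i : nat) : seq output :=
  (effect p (local_time p i) (step_event E p i) (state p i)).2.

Definition sent_to (q : Proc) (o : output) : option packet :=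
  if o is Send q' w then (if q' == q then Some w else None) else None.

Definition received_from (p : Proc) (e : event) : option packet :=
  if e is Receive p' w then (if p' == p then Some w else None) else None.

(* Packets sent by [p] to [q] in the first [i] steps of [p]. *)
Definition sent (p q : Proc) (i : nat) : seq packet :=
  flatten [seq pmap (sent_to q) (outputs p k) | k <- iota 0 i].

(* Packets from [p] received by [q] in the first [j] steps of [q]. *)
Definition received (p q : Proc) (j : nat) : seq packet :=
  pmap (fun k => received_from p (step_event E q k)) (iota 0 j).

Definition follows_algorithm (p : Proc) : Prop :=
  (forall i, guard p (local_time p i) (state p i) (step_event E p i)) /\
  (forall e i, internal e ->
     (forall j, (i <= j)%N -> guard p (local_time p j) (state p j) e) ->
     exists2 j, (i <= j)%N & step_event E p j = e).

(* Finitely many steps in finite time; since idle steps are allowed, the steps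
   can be taken to exhaust the time line. *)
Definition well_timed (p : Proc) : Prop :=
  (forall i, step_time E p i <= step_time E p i.+1) /\
  (forall t, exists i, t < step_time E p i).

Definition clock_synchrony (Psi : R) (p : Proc) : Prop :=
  {homo clock E p : t u / t <= u} /\
  (forall t, `|clock E p t - t| <= Psi).

(* Authenticated FIFO links: what has been received is always a prefix of what
   was sent no later than now. *)
Definition fifo_link (p q : Proc) : Prop :=
  forall j, exists i,
    (forall k, (k < i)%N -> step_time E p k <= step_time E q j) /\
    prefix (received p q j.+1) (sent p q i).

(* Reliability: what was sent more than [Delta] ago has been received. *)
Definition delay_bound (Delta : R) (p q : Proc) : Prop :=
  forall i j, step_time E p i + Delta < step_time E q j ->
    prefix (sent p q i.+1) (received p q j).

Definition correct_server (pi : Server) : bool := correct E (srv pi).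
Definition correct_client (c : Client) : bool := correct E (cli c).

Definition proposes (pi : Server) (x : stamp) (v : bool) (i : nat) : Prop :=
  Propose x v \in outputs (srv pi) i.

Definition decides (pi : Server) (x : stamp) (v : bool) (i : nat) : Prop :=
  step_event E (srv pi) i = Decide x v.

Definition con_integrity (x : stamp) : Prop :=
  forall pi v v' i j, correct_server pi ->
    decides pi x v i -> decides pi x v' j -> i = j.

Definition con_agreement (x : stamp) : Prop :=
  forall pi pi' v v' i j, correct_server pi -> correct_server pi' ->
    decides pi x v i -> decides pi' x v' j -> v = v'.

Definition con_termination (x : stamp) : Prop :=
  (forall pi, correct_server pi -> exists v i, proposes pi x v i) ->
  forall pi, correct_server pi -> exists v i, decides pi x v i.

Definition con_representative_validity (x : stamp) : Prop :=
  forall pi v i, correct_server pi -> decides pi x v i ->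
  exists2 Q : {set Server}, (f + 1 <= #|Q|)%N &
    forall pi', pi' \in Q -> correct_server pi' /\
      exists2 j, proposes pi' x v j &
        step_time E (srv pi') j <= step_time E (srv pi) i.

Definition representative_binary_consensus (x : stamp) : Prop :=
  [/\ con_integrity x, con_agreement x, con_termination x
    & con_representative_validity x].

Definition broadcasts (c : Client) (m : Msg) (i : nat) : Prop :=
  step_event E (cli c) i = TobBroadcast m.

Definition delivers (pi : Server) (c : Client) (m : Msg) (j : nat) : Prop :=
  TobDeliver c m \in outputs (srv pi) j.

Record flutter_execution : Prop := FlutterExecution {
  few_faults : (#|[pred pi | ~~ correct_server pi]| <= f)%N;
  algorithm : forall p, correct E p -> follows_algorithm p;
  timing : forall p, correct E p -> well_timed p;
  partial_synchrony : exists Delta Psi : R,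
    (forall p, correct E p -> clock_synchrony Psi p) /\
    (forall p q, correct E p -> correct E q -> delay_bound Delta p q);
  links : forall p q, correct E p -> correct E q -> fifo_link p q;
  consensus : forall x, representative_binary_consensus x;
  no_rebroadcast : forall c m i j, correct_client c ->
    broadcasts c m i -> broadcasts c m j -> i = j
}.

End Execution.
End Algorithm.

(* Submission.v *)
Require Import Defs.
From mathcomp Require Import all_boot all_order all_algebra finmap.
From mathcomp Require Import all_classical all_reals ereal.
From mathcomp Require Import zify lra.

(* Every submission (m, b) is observed by all correct servers, so it is decided;
   if it is rejected, all correct servers report this and the client resubmits
   with a doubled delay. Once the delay exceeds Delta + 2 Psi no correct server
   can propose False, so some stamp x = (c, m, b) is accepted.

   Then f+1 correct servers saw x before local time b, and announced it before
   beating with a time >= b. Since 4f+1 and f+1 servers out of 5f+1 intersect,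
   FIFO links ensure that a correct server whose lock time reaches b has already
   observed x, at a moment when x still qualified as a candidate; hence x is
   never skipped. From that point on the candidates up to x are a fixed finite
   set, each of them is eventually decided, and so x is eventually processed.

   A delivery of (c, m) never precedes the broadcast, because an accepted stamp
   was proposed by a correct server upon a message authenticated by c. *)

Set Implicit Arguments.
Unset Strict Implicit.
Unset Printing Implicit Defensive.

Import Order.TTheory GRing.Theory Num.Theory.
Local Open Scope ring_scope.

(** * Single steps *)

Section Steps.
Context {R : realType} (S : system R).

Local Notation stamp := (R *l Client S *l Msg S)%type.

Implicit Types (x y : stamp) (st : server_state S) (ps : pstate S).
Implicit Types (p q : Proc S) (pi : Server S) (e : event S) (now t b : R).

Lemma server_ofK pi : server_of (srv pi) = Some pi.
Proof.
rewrite /server_of; case: pickP => [pi' /eqP/(@srv_inj _ S)->//|/(_ pi)].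
by rewrite eqxx.
Qed.

Lemma client_ofK (c : Client S) : client_of (cli c) = Some c.
Proof.
rewrite /client_of; case: pselect => [h|[]]; last by exists c.
by case: cid => c' /= /(@cli_inj _ S) ->.
Qed.

Lemma server_of_Some p pi : server_of p = Some pi -> p = srv pi.
Proof. by rewrite /server_of; case: pickP => // pi' /eqP <- [<-]. Qed.

Lemma client_of_Some p (c : Client S) : client_of p = Some c -> p = cli c.
Proof. by rewrite /client_of; case: pselect => // h [<-]; case: cid. Qed.

Lemma stamp_eta x : mk_stamp (s_client x) (s_msg x) (s_time x) = x.
Proof. by case: x => -[]. Qed.

Lemma s_time_le x y : (x <= y)%O -> s_time x <= s_time y.
Proof. by rewrite !leEprodlexi => /andP[/andP[]]. Qed.

Lemma mem_to_servers (w : packet S) (o : output S) :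
  o \in to_servers w -> exists pi, o = Send (srv pi) w.
Proof. by move=> /mapP[pi _ ->]; exists pi. Qed.

Lemma to_servers_mem pi (w : packet S) : Send (srv pi) w \in to_servers w.
Proof. by apply/mapP; exists pi => //; rewrite mem_enum. Qed.

(** * The handlers [spot] and [on_message], field by field *)

Section Spot.
Variables (now : R) (x : stamp) (st : server_state S).

Lemma observed_spot : observed (spot now x st).1 = (x |` observed st)%fset.
Proof.
rewrite /spot; case: (_ < _)%E; case: ifP => /= xo; do ?by case: ifP.
  by rewrite mem_fset1U.
by rewrite mem_fset1U.
Qed.

Lemma candidates_spot : candidates (spot now x st).1 =
  if (lock_time st < (s_time x)%:E)%E then (x |` candidates st)%fset
  else candidates st.
Proof. by rewrite /spot; case: (_ < _)%E => /=; case: ifP => //; case: ifP. Qed.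

Lemma proposed_spot : proposed (spot now x st).1 = proposed st.
Proof. by rewrite /spot; case: (_ < _)%E => /=; case: ifP => //; case: ifP. Qed.

Lemma delivered_spot : delivered (spot now x st).1 = delivered st.
Proof. by rewrite /spot; case: (_ < _)%E => /=; case: ifP => //; case: ifP. Qed.

Lemma remote_times_spot : remote_times (spot now x st).1 = remote_times st.
Proof. by rewrite /spot; case: (_ < _)%E => /=; case: ifP => //; case: ifP. Qed.

Lemma decisions_spot : decisions (spot now x st).1 = decisions st.
Proof. by rewrite /spot; case: (_ < _)%E => /=; case: ifP => //; case: ifP. Qed.

Lemma last_processed_spot :
  last_processed (spot now x st).1 = last_processed st.
Proof. by rewrite /spot; case: (_ < _)%E => /=; case: ifP => //; case: ifP. Qed.

Lemma scheduled_spot : scheduled (spot now x st).1 =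
  if (x \in observed st) || (s_time x <= now) then scheduled st
  else s_time x :: scheduled st.
Proof.
by rewrite /spot; case: (_ < _)%E => /=; case: ifP => //= _; case: ifP.
Qed.

Lemma outputs_spot : (spot now x st).2 =
  if x \in observed st then [::]
  else to_servers (PObserve x) ++ (if s_time x <= now then beat S now else [::]).
Proof.
rewrite /spot; case: (_ < _)%E => /=; case: ifP => //= _; case: ifP => //=;
by rewrite cats0.
Qed.

Lemma on_messageE : on_message now x st =
  (if x \in proposed st then (spot now x st).1
   else set_proposed (x |` proposed st)%fset (spot now x st).1,
   (spot now x st).2 ++
   if x \in proposed st then [::] else [:: Propose x (now < s_time x)]).
Proof.
rewrite /on_message; have := proposed_spot.
case: (spot now x st) => st1 o1 /= ->.
by case: ifP => //; rewrite cats0.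
Qed.

Lemma proposed_on_message :
  proposed (on_message now x st).1 = (x |` proposed st)%fset.
Proof.
rewrite on_messageE /=; case: ifP => //= xp.
by rewrite proposed_spot mem_fset1U.
Qed.

End Spot.

Lemma outputs_on_message_spot now x st o :
  o \in (spot now x st).2 -> o \in (on_message now x st).2.
Proof. by rewrite on_messageE mem_cat => ->. Qed.

Definition spotE := (observed_spot, candidates_spot, proposed_spot,
  delivered_spot, remote_times_spot, decisions_spot, last_processed_spot,
  scheduled_spot).

Lemma on_message_spotE now x st :
  [/\ observed (on_message now x st).1 = observed (spot now x st).1,
      candidates (on_message now x st).1 = candidates (spot now x st).1,
      scheduled (on_message now x st).1 = scheduled (spot now x st).1 &
  [/\ delivered (on_message now x st).1 = delivered st,
      remote_times (on_message now x st).1 = remote_times st,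
      decisions (on_message now x st).1 = decisions st
    & last_processed (on_message now x st).1 = last_processed st]].
Proof. by rewrite on_messageE /=; case: ifP; rewrite /= !spotE. Qed.

(** An inversion principle for [effect]: the role tests on sender and receiver are resolved once,
    ill-addressed packets fall under [EffectNone], and both kinds of submission share one case. Each
    invariant below is then a case analysis on it. *)
Variant effect_spec p now e ps : pstate S * seq (output S) -> Prop :=
| EffectNone : effect_spec p now e ps (ps, [::])
| EffectTime t pi pi' of e = Receive (srv pi) (PTime S t) & p = srv pi' :
    effect_spec p now e ps ((on_time pi t ps.1, ps.2), [::])
| EffectObserve x pi pi' of e = Receive (srv pi) (PObserve x) & p = srv pi' :
    effect_spec p now e ps (((spot now x ps.1).1, ps.2), (spot now x ps.1).2)
| EffectMessage x pi
    of e = Receive (cli (s_client x)) (PMessage (s_msg x) (s_time x))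
    & p = srv pi :
    effect_spec p now e ps
      (((on_message now x ps.1).1, ps.2), (on_message now x ps.1).2)
| EffectDecision m b v c pi
    of e = Receive (srv pi) (PDecision m b v) & p = cli c :
    effect_spec p now e ps ((ps.1, on_report pi m b v ps.2), [::])
| EffectDecide x v of e = Decide x v :
    effect_spec p now e ps
      (((on_decide x v ps.1).1, ps.2), (on_decide x v ps.1).2)
| EffectSubmit m r of e = TobBroadcast m \/ e = Resubmit m :
    effect_spec p now e ps
      ((ps.1, (submit now m r ps.2).1), (submit now m r ps.2).2)
| EffectBeat b of e = Beat S b :
    effect_spec p now e ps
      ((set_scheduled (rem b (scheduled ps.1)) ps.1, ps.2), beat S now)
| EffectLate x of e = ProposeLate x :
    effect_spec p now e ps
      (((propose x false ps.1).1, ps.2), (propose x false ps.1).2)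
| EffectProcess x of e = Process x :
    effect_spec p now e ps (((process x ps.1).1, ps.2), (process x ps.1).2).

Lemma effectP p now e ps : effect_spec p now e ps (effect p now e ps).
Proof.
case: e => [|q [t|x|m b|m b v]|x v|m|b|x|x|m] /=; do ?by constructor.
- case ep: (server_of p) => [pi'|]; last by constructor.
  case eq: (server_of q) => [pi|]; last by constructor.
  apply: EffectTime (server_of_Some ep).
  by rewrite (server_of_Some eq).
- case ep: (server_of p) => [pi'|]; last by constructor.
  case eq: (server_of q) => [pi|]; last by constructor.
  apply: EffectObserve (server_of_Some ep).
  by rewrite (server_of_Some eq).
- case ep: (server_of p) => [pi'|]; last by constructor.
  case eq: (client_of q) => [c|]; last by constructor.
  apply: EffectMessage (server_of_Some ep).
  by rewrite (client_of_Some eq).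
- case ep: (client_of p) => [c|]; last by constructor.
  case eq: (server_of q) => [pi|]; last by constructor.
  apply: EffectDecision (client_of_Some ep).
  by rewrite (server_of_Some eq).
- by constructor; left.
- by case: (submissions ps.2).[? m]%fmap => [rb|]; constructor; right.
Qed.

(** A stamp enters [observed] only through [spot]. The same atomic step announces it, arranges the
    beat, and tests it against the lock time of the state before the step. *)
Lemma effect_observed p now e ps x :
  x \notin observed ps.1 -> x \in observed (effect p now e ps).1.1 ->
  [/\ (lock_time ps.1 < (s_time x)%:E)%E ->
        x \in candidates (effect p now e ps).1.1,
      forall pi, Send (srv pi) (PObserve x) \in (effect p now e ps).2
    & if s_time x <= now
      then forall pi, Send (srv pi) (PTime S now) \in (effect p now e ps).2
      else s_time x \in scheduled (effect p now e ps).1.1].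
Proof.
move=> xo; have spx now' y (st := ps.1) : x \in observed (spot now' y st).1 ->
  [/\ (lock_time st < (s_time x)%:E)%E -> x \in candidates (spot now' y st).1,
      forall pi, Send (srv pi) (PObserve x) \in (spot now' y st).2
    & if s_time x <= now'
      then forall pi, Send (srv pi) (PTime S now') \in (spot now' y st).2
      else s_time x \in scheduled (spot now' y st).1].
  rewrite observed_spot in_fset1U (negPf xo) orbF => /eqP <-.
  rewrite candidates_spot scheduled_spot outputs_spot (negPf xo) /=.
  split=> [->|pi|]; first by rewrite fset1U1.
    by rewrite mem_cat to_servers_mem.
  case: (s_time x <= now') => [pi|]; last by rewrite inE eqxx.
  by rewrite mem_cat to_servers_mem orbT.
case: effectP => //=; do ?by rewrite (negPf xo).
- by move=> y pi pi' _ _; exact: spx.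
- move=> y pi _ _; have [-> -> -> _] := on_message_spotE now y ps.1.
  move=> /spx[cx sx tx]; split=> // [pi'|].
    exact: outputs_on_message_spot.
  by case: ifP tx => // _ tx pi'; apply: outputs_on_message_spot.
- move=> y _; rewrite /process; case: ifP => _; rewrite /order_msg;
  do ?case: ifP => _; by rewrite /= (negPf xo).
Qed.

(** This is what later freezes the candidates: a stamp whose time the lock time has already reached
    can no longer enter. *)
Lemma effect_candidates p now e ps x :
  x \notin candidates ps.1 -> x \in candidates (effect p now e ps).1.1 ->
  (lock_time ps.1 < (s_time x)%:E)%E /\
  x \in observed (effect p now e ps).1.1.
Proof.
move=> xc; have spx y : x \in candidates (spot now y ps.1).1 ->
    (lock_time ps.1 < (s_time x)%:E)%E /\ x \in observed (spot now y ps.1).1.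
  rewrite candidates_spot observed_spot; case: ifP => [lt|_]; last first.
    by rewrite (negPf xc).
  by rewrite in_fset1U (negPf xc) orbF => /eqP ->; rewrite fset1U1.
case: effectP => //=; do ?by rewrite (negPf xc).
- by move=> y pi pi' _ _; exact: spx.
- by move=> y pi _ _; have [-> -> _ _] := on_message_spotE now y ps.1; exact: spx.
- move=> y _; rewrite /process; case: ifP => _; rewrite /order_msg;
  do ?case: ifP => _; by rewrite /= (negPf xc).
Qed.

Lemma effect_proposed p now e ps x :
  x \notin proposed ps.1 -> x \in proposed (effect p now e ps).1.1 ->
  exists v, Propose x v \in (effect p now e ps).2.
Proof.
move=> xp; case: effectP => //=; do ?by rewrite (negPf xp).
- by move=> y pi pi' _ _; rewrite proposed_spot (negPf xp).
- move=> y pi _ _; rewrite proposed_on_message in_fset1U (negPf xp) orbF.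
  move=> /eqP <-; rewrite on_messageE (negPf xp) /=; exists (now < s_time x).
  by rewrite mem_cat mem_seq1 eqxx orbT.
- move=> y _; rewrite in_fset1U (negPf xp) orbF => /eqP ->.
  by exists false; rewrite mem_seq1.
- move=> y _; rewrite /process; case: ifP => _; rewrite /order_msg;
  do ?case: ifP => _; by rewrite /= (negPf xp).
Qed.

Lemma effect_mono p now e ps x
    (st := ps.1) (st' := (effect p now e ps).1.1) :
  [/\ x \in observed st -> x \in observed st',
      x \in proposed st -> x \in proposed st',
      x \in candidates st -> x \in candidates st'
    & x \in decisions st -> x \in decisions st'].
Proof.
rewrite {}/st'; have spx now' y :
    (x \in observed st -> x \in observed (spot now' y st).1) /\
    (x \in candidates st -> x \in candidates (spot now' y st).1).
  rewrite observed_spot candidates_spot; split; first exact: fset1Ur.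
  by case: ifP => // _; exact: fset1Ur.
case: effectP => //=.
- by move=> y pi0 pi' _ _; have [? ?] := spx now y; split=> //; rewrite spotE.
- move=> y pi0 _ _; rewrite proposed_on_message.
  have [-> -> _ [_ _ -> _]] := on_message_spotE now y ps.1.
  by have [? ?] := spx now y; split=> //; exact: fset1Ur.
- move=> y v _; split=> // yd; exact: fset1Ur.
- move=> y _; split=> //; exact: fset1Ur.
- by move=> y _; rewrite /process; case: ifP => _; rewrite /order_msg;
    do ?case: ifP => _.
Qed.

Lemma effect_remote_times_mono p now e ps pi :
  (remote_times ps.1 pi <= remote_times (effect p now e ps).1.1 pi)%E.
Proof.
case: effectP => //=.
- move=> t pi0 pi' _ _; case: eqP => // ->.
  by rewrite le_max lexx.
- by move=> y pi0 pi' _ _; rewrite spotE.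
- by move=> y pi0 _ _; have [_ _ _ [_ -> _ _]] := on_message_spotE now y ps.1.
- by move=> y _; rewrite /process; case: ifP => _; rewrite /order_msg;
    do ?case: ifP => _.
Qed.

Lemma effect_remote_times p now e ps pi b :
  (b%:E <= remote_times (effect p now e ps).1.1 pi)%E ->
  (b%:E <= remote_times ps.1 pi)%E \/
  exists2 t, e = Receive (srv pi) (PTime S t) & b <= t.
Proof.
case: effectP => /=; do ?by left.
- move=> t pi0 pi' -> _; case: eqP => [->|_]; last by left.
  by rewrite le_max => /orP[]; [left|rewrite lee_fin; right; exists t].
- by move=> x pi0 pi' _ _; rewrite spotE; left.
- move=> x pi0 _ _; have [_ _ _ [_ -> _ _]] := on_message_spotE now x ps.1.
  by left.
- by move=> x _; rewrite /process; case: ifP => _; rewrite /order_msg;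
    do ?case: ifP => _; left.
Qed.

(** Used in contrapositive form: a scheduled beat stays pending until it fires, so fairness applies
    to it. *)
Lemma effect_scheduled p now e ps b :
  b \in scheduled ps.1 -> b \notin scheduled (effect p now e ps).1.1 ->
  e = Beat S b.
Proof.
move=> bs; case: effectP => //=; do ?by rewrite bs.
- move=> x pi0 pi' _ _; rewrite scheduled_spot; case: ifP; rewrite ?inE bs //.
  by rewrite orbT.
- move=> x pi0 _ _; have [_ _ -> _] := on_message_spotE now x ps.1.
  rewrite scheduled_spot; case: ifP; rewrite ?inE bs //.
  by rewrite orbT.
- move=> b' ->; have [->//|bb'] := eqVneq b b'.
  by move=> /negP[]; rewrite rem_mem.
- by move=> x _; rewrite /process; case: ifP => _; rewrite /order_msg;
    do ?case: ifP => _; rewrite /= bs.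
Qed.

Lemma process_last_processed p now x ps :
  last_processed (effect p now (Process x) ps).1.1 = Some x.
Proof.
by rewrite /= /process; case: ifP => _ //; rewrite /order_msg; case: ifP.
Qed.

Lemma effect_last_processed p now e ps : (forall x, e <> Process x) ->
  last_processed (effect p now e ps).1.1 = last_processed ps.1.
Proof.
move=> eN; case: effectP => //=.
- by move=> y pi0 pi' _ _; rewrite spotE.
- by move=> y pi0 _ _; have [_ _ _ []] := on_message_spotE now y ps.1.
- by move=> y /eN.
Qed.

Lemma effect_decisions p now e ps x v :
  (decisions (effect p now e ps).1.1).[? x]%fmap = Some v ->
  (decisions ps.1).[? x]%fmap = Some v \/ e = Decide x v.
Proof.
case: effectP => /=; do ?by left.
- by move=> y pi0 pi' _ _; rewrite spotE; left.
- move=> y pi0 _ _; have [_ _ _ [_ _ -> _]] := on_message_spotE now y ps.1.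
  by left.
- move=> y v' ->; rewrite fnd_set; case: eqP => [->|_]; last by left.
  by move=> [->]; right.
- by move=> y _; rewrite /process; case: ifP => _; rewrite /order_msg;
    do ?case: ifP => _; left.
Qed.

Lemma effect_delivered p now e ps c m :
  (c, m) \in delivered (effect p now e ps).1.1 -> (c, m) \notin delivered ps.1 ->
  TobDeliver c m \in (effect p now e ps).2.
Proof.
move=> + cm; case: effectP => /=; do ?by rewrite (negPf cm).
- by move=> y pi0 pi' _ _; rewrite spotE (negPf cm).
- move=> y pi0 _ _; have [_ _ _ [-> _ _ _]] := on_message_spotE now y ps.1.
  by rewrite (negPf cm).
- move=> x _; rewrite /process; case: ifP => _ /=; last by rewrite (negPf cm).
  rewrite /order_msg; case: ifP => _ /=; first by rewrite (negPf cm).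
  rewrite in_fset1U (negPf cm) orbF => /eqP[-> ->]; by rewrite mem_seq1.
Qed.

Lemma effect_submissions p now e ps m :
  (submissions (effect p now e ps).1.2).[? m]%fmap =
    (submissions ps.2).[? m]%fmap \/ e = TobBroadcast m \/ e = Resubmit m.
Proof.
case: effectP => /=; do ?by left.
move=> m' r [] ->; rewrite fnd_set; case: eqP => [->|_]; auto.
Qed.

(** The guard serves the event [ProposeLate], whose effect alone does not tell that [x] is still
    unproposed and that its time has passed. *)
Lemma effect_propose p now e ps x v : guard p now ps e ->
  Propose x v \in (effect p now e ps).2 ->
  x \notin proposed ps.1 /\
  ((e = Receive (cli (s_client x)) (PMessage (s_msg x) (s_time x)) /\
    v = (now < s_time x)) \/ (v = false /\ s_time x <= now)).
Proof.
move=> g; have tsN w : Propose x v \in @to_servers R S w -> False.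
  by move=> /mem_to_servers[].
have spN y : Propose x v \in (spot now y ps.1).2 -> False.
  rewrite outputs_spot; case: ifP => // _; rewrite mem_cat => /orP[/tsN//|].
  by case: ifP => // _ /tsN.
move: g; case: effectP => //=; do ?by move=> *; exfalso; eauto.
- move=> y pi -> _ _ /=.
  rewrite on_messageE /= mem_cat => /orP[/spN//|].
  case: ifP => // yp; rewrite mem_seq1 => /eqP[-> ->].
  by split; [rewrite yp|left].
- by move=> y v' _ _; rewrite mem_seq1 => /eqP.
- move=> y -> /= [_ yo yp yt]; rewrite mem_seq1 => /eqP[-> ->]; split=> //.
  by right.
- move=> y _ _; rewrite /process; case: ifP => _ //=.
  by rewrite /order_msg; case: ifP => //= _; rewrite mem_seq1 => /eqP.
Qed.

(** Traces a packet back to the event that emitted it. The clock value in a [PTime] packet is what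
    the FIFO argument relies on. *)
Lemma effect_send p now e ps q w : Send q w \in (effect p now e ps).2 ->
  match w with
  | PTime t => t = now
  | PObserve _ => True
  | PMessage m b => e = TobBroadcast m \/ e = Resubmit m
  | PDecision m b v =>
      exists2 c, q = cli c & e = Decide (mk_stamp c m b) v
  end.
Proof.
have spN y : Send q w \in (spot now y ps.1).2 ->
    w = PObserve y \/ w = PTime S now.
  rewrite outputs_spot; case: ifP => // _; rewrite mem_cat => /orP[|].
    by move=> /mem_to_servers[pi [_ ->]]; left.
  by case: ifP => // _ /mem_to_servers[pi [_ ->]]; right.
case: effectP => //=.
- by move=> x pi pi' _ _ /spN[->|->].
- move=> x pi _ _; rewrite on_messageE mem_cat => /orP[/spN[->|->]//|].
  by case: ifP => //= _; rewrite mem_seq1 => /eqP.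
- move=> x v ->; rewrite mem_seq1 => /eqP[-> ->]; exists (s_client x) => //.
  by rewrite stamp_eta.
- by move=> m r He /mem_to_servers[pi [_ ->]]; exact: He.
- by move=> b _ /mem_to_servers[pi [_ ->]].
- by move=> x _; rewrite mem_seq1 => /eqP.
- move=> y _; rewrite /process; case: ifP => _ //=.
  by rewrite /order_msg; case: ifP => //= _; rewrite mem_seq1 => /eqP.
Qed.

Lemma effect_deliver p now e ps c m : TobDeliver c m \in (effect p now e ps).2 ->
  exists2 b, e = Process (mk_stamp c m b) &
    (decisions ps.1).[? mk_stamp c m b]%fmap = Some true.
Proof.
have tsN w : TobDeliver c m \in @to_servers R S w -> False.
  by move=> /mem_to_servers[].
have spN y : TobDeliver c m \in (spot now y ps.1).2 -> False.
  rewrite outputs_spot; case: ifP => // _; rewrite mem_cat => /orP[/tsN//|].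
  by case: ifP => // _ /tsN.
case: effectP => //=; do ?by move=> *; exfalso; eauto.
- move=> x pi _ _; rewrite on_messageE mem_cat => /orP[/spN//|].
  by case: ifP => //= _; rewrite mem_seq1 => /eqP.
- by move=> y v _; rewrite mem_seq1 => /eqP.
- by move=> y _; rewrite mem_seq1 => /eqP.
- move=> x ->; rewrite /process; case: ifP => // /eqP dx.
  rewrite /order_msg; case: ifP => //= _; rewrite mem_seq1 => /eqP[-> ->].
  by exists (s_time x); rewrite stamp_eta.
Qed.

(** * State reached on receipt of each kind of packet *)

Lemma receive_observe now ps x pi pi' :
  x \in observed
    (effect (srv pi) now (Receive (srv pi') (PObserve x)) ps).1.1.
Proof. by rewrite /= !server_ofK /= observed_spot fset1U1. Qed.

Lemma receive_message now ps c m b pi (x := mk_stamp c m b)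
    (st' := (effect (srv pi) now (Receive (cli c) (PMessage m b)) ps).1.1) :
  x \in observed st' /\ x \in proposed st'.
Proof.
rewrite {}/st' /= server_ofK client_ofK /= proposed_on_message fset1U1.
have [-> _ _ _] := on_message_spotE now x ps.1.
by rewrite observed_spot fset1U1.
Qed.

Lemma receive_time now ps t pi pi' :
  (t%:E <= remote_times
     (effect (srv pi) now (Receive (srv pi') (PTime S t)) ps).1.1 pi')%E.
Proof. by rewrite /= !server_ofK /= eqxx le_max lexx orbT. Qed.

Lemma receive_decision now ps c m b v pi :
  (reports (effect (cli c) now (Receive (srv pi) (PDecision m b v)) ps).1.2
    ).[? (m, b, pi)]%fmap = Some v.
Proof. by rewrite /= client_ofK server_ofK /= fnd_set eqxx. Qed.

(** Only another decision packet from the same server can overwrite the report; agreement of the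
    consensus instance will provide the condition on [v']. *)
Lemma reports_kept p now e ps m b pi v :
  (reports ps.2).[? (m, b, pi)]%fmap = Some v ->
  (forall v', e = Receive (srv pi) (PDecision m b v') -> v' = v) ->
  (reports (effect p now e ps).1.2).[? (m, b, pi)]%fmap = Some v.
Proof.
move=> rv; case: effectP => //=.
move=> m' b' v' c pi' -> _ vv; rewrite fnd_set.
by case: eqP vv => [[-> -> ->] /(_ _ erefl) ->|//].
Qed.

Lemma process_delivered p now x ps :
  (decisions ps.1).[? x]%fmap = Some true ->
  (s_client x, s_msg x) \in delivered (effect p now (Process x) ps).1.1.
Proof.
rewrite /= /process => ->; rewrite eqxx /order_msg; case: ifP => //= _.
exact: fset1U1.
Qed.

End Steps.

(** * Prefixes, eventual properties, minima and the lock time as a count *)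

Lemma prefix_cmp (T : eqType) (s1 s2 s : seq T) :
  prefix s1 s -> prefix s2 s -> prefix s1 s2 \/ prefix s2 s1.
Proof.
elim: s1 s2 s => [|a s1 IH] [|b s2] [|d s] //=; auto.
by move=> /andP[/eqP -> p1] /andP[/eqP -> p2]; rewrite eqxx; exact: IH p1 p2.
Qed.

Lemma eventually_all (T : finType) (P : T -> nat -> Prop) :
  (forall a j k, (j <= k)%N -> P a j -> P a k) ->
  (forall a, exists j, P a j) -> exists j, forall a, P a j.
Proof.
move=> Pmono /choice[g Pg]; exists (\max_a g a)%N => a.
by apply: Pmono (Pg a); exact: leq_bigmax.
Qed.

Lemma exists_min d (T : orderType d) (s : seq T) x : x \in s ->
  exists2 y, y \in s & forall z, z \in s -> (y <= z)%O.
Proof.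
move=> xs; have {}xs : ~~ nilp s by case: s xs.
elim: s xs => // a [|b s] IH _.
  by exists a; rewrite ?mem_seq1 // => z; rewrite mem_seq1 => /eqP ->.
have [//|y ys ymin] := IH; case: (leP a y) => ay.
  exists a; first by rewrite mem_head.
  by move=> z; rewrite inE => /predU1P[->//|/ymin]; exact: le_trans.
exists y; first by rewrite inE ys orbT.
by move=> z; rewrite inE => /predU1P[->|/ymin//]; exact: ltW.
Qed.

(** The supremum is attained and [lock_set] is downward closed, so comparisons with the lock time
    become counts of remote times. *)
Lemma lock_time_ge (R : realType) (S : system R) (st : server_state S) t :
  (t <= lock_time st)%E <->
  (4 * faults S + 1 <= #|[pred pi | (t <= remote_times st pi)%E]|)%N.
Proof.
have [lockm lockub] := lock_time_max st; split; last exact: lockub.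
move=> tl; apply: leq_trans lockm _; apply/subset_leq_card/fintype.subsetP => pi.
by rewrite !inE; exact: le_trans.
Qed.

(** * Links and clocks *)

Section Execution.
Context {R : realType} (S : system R) (E : execution S).
Hypothesis hE : flutter_execution E.

Local Notation stamp := (R *l Client S *l Msg S)%type.
Local Notation sst pi j := (state E (srv pi) j).1.
Local Notation correct_server := (correct_server E).

Implicit Types (x y : stamp) (p q : Proc S) (pi : Server S) (w : packet S).

Lemma stateS p i : state E p i.+1 =
  (effect p (local_time E p i) (step_event E p i) (state E p i)).1.
Proof. by []. Qed.

Lemma mem_sent p q i w :
  reflect (exists2 k, (k < i)%N & Send q w \in outputs E p k)
    (w \in sent E p q i).
Proof.
apply: (iffP flattenP) => [[s /mapP[k]]|[k ki sk]].
  rewrite mem_iota /= add0n => ki ->; rewrite mem_pmap => /mapP[o os].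
  rewrite /sent_to; case: o os => // q' w' os; case: eqP => // <- [->].
  by exists k.
exists (pmap (sent_to q) (outputs E p k)).
  by apply/mapP; exists k => //; rewrite mem_iota.
by rewrite mem_pmap; apply/mapP; exists (Send q w) => //=; rewrite eqxx.
Qed.

Lemma mem_received p q j w :
  reflect (exists2 k, (k < j)%N & step_event E q k = Receive p w)
    (w \in received E p q j).
Proof.
rewrite /received mem_pmap; apply: (iffP mapP) => [[k]|[k kj ek]].
  rewrite mem_iota /= add0n => kj; rewrite /received_from.
  case ek: step_event => [|p' w'||||||] //; case: eqP => // pp [->].
  by exists k; rewrite // ek pp.
by exists k; rewrite ?mem_iota // ek /= eqxx.
Qed.

Lemma sent_prefix p q i j : (i <= j)%N -> prefix (sent E p q i) (sent E p q j).
Proof.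
move=> /subnKC <-; rewrite /sent iotaD map_cat flatten_cat; exact: prefix_prefix.
Qed.

Lemma step_time_homo p i j : correct E p -> (i <= j)%N ->
  step_time E p i <= step_time E p j.
Proof.
move=> /(timing hE)[mono _]; exact: (homo_leq (@lexx _ _) (@le_trans _ _) mono).
Qed.

Lemma local_time_homo p i j : correct E p -> (i <= j)%N ->
  local_time E p i <= local_time E p j.
Proof.
move=> cp ij; have [Delta [Psi [/(_ p cp)[mono _] _]]] := partial_synchrony hE.
exact/mono/step_time_homo.
Qed.

Lemma local_time_unbounded p (t : R) : correct E p ->
  exists i, forall j, (i <= j)%N -> t <= local_time E p j.
Proof.
move=> cp; have [Delta [Psi [/(_ p cp)[mono clk] _]]] := partial_synchrony hE.
have [_ /(_ (t + Psi))[i ti]] := timing hE cp; exists i => j ij.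
have := step_time_homo cp ij; have := clk (step_time E p j).
rewrite -/(local_time E p j) ler_norml => /andP[]; lra.
Qed.

Lemma guard_step p i : correct E p ->
  guard p (local_time E p i) (state E p i) (step_event E p i).
Proof. by move=> /(algorithm hE)[]. Qed.

(** The steps of [q] exhaust the time line, so one of them lies more than [Delta] after the
    sending. *)
Lemma eventually_received p q i w : correct E p -> correct E q ->
  Send q w \in outputs E p i -> exists k, step_event E q k = Receive p w.
Proof.
move=> cp cq sw; have [Delta [Psi [_ /(_ p q cp cq) dl]]] := partial_synchrony hE.
have [_ /(_ (step_time E p i + Delta))[j /dl/prefixP[s rs]]] := timing hE cq.
have /mem_received[k _ ek] : w \in received E p q j.
  rewrite rs mem_cat; apply/orP; left; apply/mem_sent; exists i => //.
by exists k.
Qed.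

Lemma received_sent p q j w : correct E p -> correct E q ->
  step_event E q j = Receive p w ->
  exists2 k, Send q w \in outputs E p k & step_time E p k <= step_time E q j.
Proof.
move=> cp cq ej; have [i [it /prefixP[s si]]] := links hE cp cq j.
have /mem_sent[k ki sk] : w \in sent E p q i.
  rewrite si mem_cat; apply/orP; left; apply/mem_received.
  by exists j.
by exists k => //; exact: it.
Qed.

(** What has been received and what was sent in the first [s] steps are prefixes of one common
    sequence, hence comparable. As [w'] is in the former but not in the latter, the latter is the
    shorter one. *)
Lemma fifo_order p q s j w w' : correct E p -> correct E q ->
  w \in sent E p q s -> w' \notin sent E p q s ->
  w' \in received E p q j -> w \in received E p q j.
Proof.
move=> cp cq ws w's; case: j => [//|j] w'r.
have [i [_ ri]] := links hE cp cq j.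
have := prefix_cmp (prefix_trans ri (sent_prefix p q (leq_maxl i s)))
  (sent_prefix p q (leq_maxr i s)).
move=> [/prefixP[u su]|/prefixP[u ru]].
  by move: w's; rewrite su mem_cat w'r.
by rewrite ru mem_cat ws.
Qed.

(** Traces a fact about a state back to a step that made it true. *)
Lemma first_step p (Q : pstate S -> bool) j : ~~ Q (init S) -> Q (state E p j) ->
  exists2 k, (k < j)%N & ~~ Q (state E p k) /\ Q (state E p k.+1).
Proof.
move=> Q0; elim: j => [|j IH] Qj; first by rewrite Qj in Q0.
have [/IH[k kj Qk]|Qj'] := boolP (Q (state E p j)); last by exists j.
by exists k => //; exact: ltnW.
Qed.

(** * Monotonicity along an execution *)

Lemma state_mono p (Q : pstate S -> Prop) j k :
  (forall i, Q (state E p i) -> Q (state E p i.+1)) -> (j <= k)%N ->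
  Q (state E p j) -> Q (state E p k).
Proof.
move=> QS /subnKC <-; elim: (k - j)%N => [|n IH]; first by rewrite addn0.
by rewrite addnS => /IH/QS.
Qed.

Lemma observed_mono p x j k : (j <= k)%N ->
  x \in observed (state E p j).1 -> x \in observed (state E p k).1.
Proof.
apply: (state_mono (Q := fun ps => x \in observed ps.1)) => i.
by rewrite stateS; have [] := effect_mono p (local_time E p i)
  (step_event E p i) (state E p i) x.
Qed.

Lemma proposed_mono p x j k : (j <= k)%N ->
  x \in proposed (state E p j).1 -> x \in proposed (state E p k).1.
Proof.
apply: (state_mono (Q := fun ps => x \in proposed ps.1)) => i.
by rewrite stateS; have [] := effect_mono p (local_time E p i)
  (step_event E p i) (state E p i) x.
Qed.

Lemma candidates_mono p x j k : (j <= k)%N ->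
  x \in candidates (state E p j).1 -> x \in candidates (state E p k).1.
Proof.
apply: (state_mono (Q := fun ps => x \in candidates ps.1)) => i.
by rewrite stateS; have [] := effect_mono p (local_time E p i)
  (step_event E p i) (state E p i) x.
Qed.

Lemma decisions_mono p x j k : (j <= k)%N ->
  x \in decisions (state E p j).1 -> x \in decisions (state E p k).1.
Proof.
apply: (state_mono (Q := fun ps => x \in decisions ps.1)) => i.
by rewrite stateS; have [] := effect_mono p (local_time E p i)
  (step_event E p i) (state E p i) x.
Qed.

Lemma remote_times_mono p pi t j k : (j <= k)%N ->
  (t <= remote_times (state E p j).1 pi)%E ->
  (t <= remote_times (state E p k).1 pi)%E.
Proof.
apply: (state_mono (Q := fun ps => (t <= remote_times ps.1 pi)%E)) => i /le_trans.
apply; exact: effect_remote_times_mono.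
Qed.

(** * Servers *)

Lemma correct_quorum : (4 * faults S + 1 <= #|[pred pi | correct_server pi]|)%N.
Proof.
set C := [pred pi : Server S | correct_server pi].
have CC : #|[pred pi | ~~ correct_server pi]| = #|[predC C]|.
  by apply: eq_card => pi; rewrite !inE.
have := cardC C; have := few_faults hE; rewrite CC card_server.
set a := #|_|; set b := #|_|; lia.
Qed.

Lemma candidates_observed p x j :
  x \in candidates (state E p j).1 -> x \in observed (state E p j).1.
Proof.
move=> xc; have [//|k kj [kN kc]] :=
  first_step (Q := fun ps => x \in candidates ps.1) _ xc.
by have [_] := effect_candidates kN kc; exact: (@observed_mono p x k.+1).
Qed.

Lemma proposed_proposes pi x j : x \in proposed (sst pi j) ->
  exists v k, proposes E pi x v k.
Proof.
move=> xp; have [//|k kj [kN kp]] :=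
  first_step (Q := fun ps => x \in proposed ps.1) _ xp.
by have [v] := effect_proposed kN kp; exists v, k.
Qed.

Lemma observed_first pi x j : x \in observed (sst pi j) -> exists2 k, (k < j)%N &
  [/\ x \notin observed (sst pi k),
    (lock_time (sst pi k) < (s_time x)%:E)%E -> x \in candidates (sst pi k.+1),
    forall pi', Send (srv pi') (PObserve x) \in outputs E (srv pi) k
  & if s_time x <= local_time E (srv pi) k
    then forall pi', Send (srv pi') (PTime S (local_time E (srv pi) k))
           \in outputs E (srv pi) k
    else s_time x \in scheduled (sst pi k.+1)].
Proof.
move=> xo; have [//|k kj [kN ko]] :=
  first_step (Q := fun ps => x \in observed ps.1) _ xo.
by exists k => //; have [] := effect_observed kN ko.
Qed.

Lemma observed_everywhere pi pi' x j : correct_server pi -> correct_server pi' ->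
  x \in observed (sst pi j) -> exists k, x \in observed (sst pi' k).
Proof.
move=> cpi cpi' /observed_first[k kj [_ _ /(_ pi') sx _]].
have [i ei] := eventually_received cpi cpi' sx.
by exists i.+1; rewrite stateS ei receive_observe.
Qed.

(** If [x] were never proposed, [ProposeLate x] would stay enabled once the local clock has passed
    [s_time x], and fairness would trigger it. *)
Lemma observed_proposed pi x j : correct_server pi ->
  x \in observed (sst pi j) -> exists k, x \in proposed (sst pi k).
Proof.
move=> cpi xo; apply/not_existsP => xpN.
have [i ti] := local_time_unbounded (s_time x) cpi.
have [_ /(_ (ProposeLate x) (maxn i j) isT)] := algorithm hE cpi.
case=> [k|k _ ek].
  rewrite geq_max => /andP[ik jk]; split; [by exists pi| | |exact: ti].
    exact: observed_mono xo.
  exact/negP/xpN.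
by apply: (xpN k.+1); rewrite stateS ek /= fset1U1.
Qed.

(** The announcement of [x] reaches every correct server, each of them proposes, and termination of
    the consensus instance applies. *)
Lemma observed_decides pi pi' x j : correct_server pi -> correct_server pi' ->
  x \in observed (sst pi j) -> exists v k, decides E pi' x v k.
Proof.
move=> cpi cpi' xo; have [_ _ term _] := consensus hE x.
apply: term => // pi'' cpi''.
have [k /(observed_proposed cpi'')[i]] := observed_everywhere cpi cpi'' xo.
exact: proposed_proposes.
Qed.

Lemma decides_decision pi x v k : decides E pi x v k ->
  x \in decisions (sst pi k.+1).
Proof. by rewrite /decides stateS => -> /=; rewrite fset1U1. Qed.

(** The beat is sent in the observing step itself or scheduled there. In the latter case it remains
    enabled from local time [s_time x] on, until fairness fires it. *)
Lemma observed_beat pi x j : correct_server pi -> x \in observed (sst pi j) ->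
  exists k t, s_time x <= t /\
    forall pi', Send (srv pi') (PTime S t) \in outputs E (srv pi) k.
Proof.
move=> cpi /observed_first[k kj [_ _ _]]; case: ifP => [xt st|_ sch].
  by exists k, (local_time E (srv pi) k).
have [i ti] := local_time_unbounded (s_time x) cpi.
suff [n en] : exists n, step_event E (srv pi) n = Beat S (s_time x).
  exists n, (local_time E (srv pi) n); split.
    by have := guard_step n cpi; rewrite en => -[].
  by move=> pi'; rewrite /outputs en /= to_servers_mem.
apply: contrapT => /forallNP noBeat.
have [_ /(_ (Beat S (s_time x)) (maxn i k.+1) isT)] := algorithm hE cpi.
case=> [n|n _ en]; last by case: (noBeat n).
rewrite geq_max => /andP[ni nk].
split; [by exists pi| |exact: ti].
apply: (state_mono (Q := fun ps => s_time x \in scheduled ps.1)) nk sch => n' sn'.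
apply: contraT => /(effect_scheduled sn') en.
by case: (noBeat n').
Qed.

(** Every correct server observes [x] and then beats with a time at least [s_time x]; the correct
    servers alone form a quorum of 4f+1. *)
Lemma lock_time_reached pi pi' x j : correct_server pi -> correct_server pi' ->
  x \in observed (sst pi j) ->
  exists k, ((s_time x)%:E <= lock_time (sst pi' k))%E.
Proof.
move=> cpi cpi' xo.
have [|q|k rk] := @eventually_all (Server S)
  (fun (q : Server S) k => correct_server q ->
   ((s_time x)%:E <= remote_times (sst pi' k) q)%E).
- by move=> q i k ik rq cq; apply: remote_times_mono ik (rq cq).
- have [cq|_] := boolP (correct_server q); last by exists 0%N.
  have [i xi] := observed_everywhere cpi cq xo.
  have [n [t [xt /(_ pi') st]]] := observed_beat cq xi.
  have [k ek] := eventually_received cq cpi' st.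
  exists k.+1 => _; rewrite stateS ek; apply: le_trans (receive_time _ _ _ _ _).
  by rewrite lee_fin.
exists k; apply/lock_time_ge/(leq_trans correct_quorum).
apply/subset_leq_card/fintype.subsetP => q; rewrite !inE; exact: rk.
Qed.

Lemma lock_time_mono pi t j k : (j <= k)%N ->
  (t <= lock_time (sst pi j))%E -> (t <= lock_time (sst pi k))%E.
Proof.
move=> jk /lock_time_ge tj; apply/lock_time_ge/(leq_trans tj).
apply/subset_leq_card/fintype.subsetP => q; rewrite !inE.
exact: remote_times_mono.
Qed.

Lemma proposes_true pi x j : correct_server pi -> proposes E pi x true j ->
  step_event E (srv pi) j =
    Receive (cli (s_client x)) (PMessage (s_msg x) (s_time x)) /\
  local_time E (srv pi) j < s_time x.
Proof.
move=> cpi /(effect_propose (guard_step j cpi))[_ [[-> <-]//|[]//]].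
Qed.

(* A quorum of 4f+1 servers that have passed the time of [x] meets every set
   of f+1 proposers; such a proposer announced [x] before that time, and
   links are FIFO. *)
Lemma lock_time_observed x (Q : {set Server S}) pi j :
  (faults S + 1 <= #|Q|)%N ->
  (forall q : Server S, q \in Q ->
     correct_server q /\ exists k, proposes E q x true k) ->
  correct_server pi -> ((s_time x)%:E <= lock_time (sst pi j))%E ->
  x \in observed (sst pi j).
Proof.
move=> cardQ hQ cpi /lock_time_ge cardA.
set A := [pred _ | _] in cardA.
have /card_gt0P[q] : (0 < #|[predI A & Q]|)%N.
  (* Inclusion-exclusion: the two cardinals add up to at least 5f+2, while the union has at most
     5f+1 elements. *)
  rewrite -(ltn_add2l #|[predU A & Q]|) addn0 cardUI.
  apply: leq_ltn_trans (max_card _) _; rewrite card_server.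
  by apply: leq_trans (leq_add cardA cardQ); lia.
rewrite !inE => /andP[rq /hQ[cq [s /(proposes_true cq)[es ts]]]].
(* Step [k] receives the beat of [q] that lifts its remote time to [s_time x] or more. *)
have [|k kj [kN kr]] := first_step
  (Q := fun ps => ((s_time x)%:E <= remote_times ps.1 q)%E) _ rq.
  by [].
have [kr'|[t ek xt]] := effect_remote_times kr; first by rewrite kr' in kN.
(* By step [s], where it proposes, [q] has announced [x]. *)
have [|s' s's [_ _ /(_ pi) sx _]] := @observed_first q x s.+1.
  rewrite stateS es; have [] := receive_message (local_time E (srv q) s)
    (state E (srv q) s) (s_client x) (s_msg x) (s_time x) q.
  by rewrite stamp_eta.
have /mem_received[i ij ei] : PObserve x \in received E (srv q) (srv pi) j.
  apply: (fifo_order (s := s'.+1) (w' := PTime S t) cq cpi).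
  - by apply/mem_sent; exists s'.
  (* Up to step [s] the clock of [q] is below [s_time x], hence below [t], so this beat is sent
     after the announcement. *)
  - apply/mem_sent => -[n ns /effect_send tn].
    suff : t <= local_time E (srv q) s by lra.
    by rewrite tn; apply: local_time_homo => //; lia.
  - by apply/mem_received; exists k.
by apply: observed_mono ij _; rewrite stateS ei receive_observe.
Qed.

(** * Processing of candidates in stamp order *)

Section Processing.
Variables (pi : Server S) (x : stamp).
Hypothesis cpi : correct_server pi.
Hypothesis lock_observed : forall j,
  ((s_time x)%:E <= lock_time (sst pi j))%E -> x \in observed (sst pi j).

(** When [x] is first observed, the lock time is still below [s_time x]: otherwise [lock_observed]
    would have [x] observed before that step. The candidate test therefore succeeds. *)
Lemma lock_time_candidate j :
  ((s_time x)%:E <= lock_time (sst pi j))%E -> x \in candidates (sst pi j).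
Proof.
move=> /lock_observed /observed_first[k kj [kN kc _ _]].
apply: candidates_mono kj _; apply: kc; rewrite ltNge.
by apply: contra kN; exact: lock_observed.
Qed.

Lemma last_processedS j :
  last_processed (sst pi j.+1) =
    if step_event E (srv pi) j is Process y then Some y
    else last_processed (sst pi j).
Proof.
rewrite stateS; case ee: step_event => [|q w|y v|m|b|y|y|m];
  do ?exact: effect_last_processed.
exact: process_last_processed.
Qed.

(** The guard of [Process] makes [last_processed] increase only. *)
Lemma after_lastS y j : after_last (sst pi j.+1) y -> after_last (sst pi j) y.
Proof.
rewrite /after_last last_processedS; have := guard_step j cpi.
case: step_event => // z [_ [_ + _] _ _]; rewrite /after_last.
by case: last_processed => // u; exact: lt_trans.
Qed.

(** Processing cannot skip [x]: if the lock time has reached [s_time x], then [x] is a candidate and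
    competes for the minimum; if not, only stamps of smaller time can be processed. *)
Lemma next_le j y : guard (srv pi) (local_time E (srv pi) j)
    (state E (srv pi) j) (Process y) ->
  after_last (sst pi j) x -> (y <= x)%O.
Proof.
move=> [_ [_ _ ymin] _ yl] xl; case: (leP (s_time x)%:E (lock_time (sst pi j))).
  by move=> /lock_time_candidate xc; exact: ymin.
move=> lx; rewrite leNgt; apply/negP => /ltW /s_time_le; rewrite leNgt.
by rewrite -lte_fin (le_lt_trans yl lx).
Qed.

Lemma after_last_unprocessed j :
  (forall k, step_event E (srv pi) k <> Process x) -> after_last (sst pi j) x.
Proof.
move=> unp; elim: j => [//|j IH]; rewrite /after_last last_processedS.
have := guard_step j cpi; case ee: step_event => [|q w|y v|m|b|y|y|m] // g.
rewrite lt_neqAle (next_le g IH) andbT.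
by apply/eqP => yx; apply: (unp j); rewrite ee yx.
Qed.

(** A new candidate must have a time above the current lock time, which is already at least
    [s_time x]. *)
Lemma candidates_frozen i j y : (i <= j)%N ->
  ((s_time x)%:E <= lock_time (sst pi i))%E -> (y <= x)%O ->
  y \in candidates (sst pi j) -> y \in candidates (sst pi i).
Proof.
move=> /subnKC <- li yx; elim: (j - i)%N => [|n IH]; first by rewrite addn0.
rewrite addnS => yc.
apply: IH; apply: contraT => yN; have [] := effect_candidates yN yc.
have := lock_time_mono (leq_addr n i) li; move=> /le_lt_trans h /h.
by rewrite lte_fin ltNge s_time_le.
Qed.

(** By contradiction and descent: as long as [x] is unprocessed it is pending, further processing
    steps keep occurring, and each removes a stamp from a finite set of pending ones. *)
Lemma eventually_processed j0 :
  ((s_time x)%:E <= lock_time (sst pi j0))%E ->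
  exists k, step_event E (srv pi) k = Process x.
Proof.
move=> l0; apply: contrapT => /forallNP unp.
have xafter j := after_last_unprocessed j unp.
have lj j : (j0 <= j)%N -> ((s_time x)%:E <= lock_time (sst pi j))%E.
  by move=> jj; exact: lock_time_mono jj l0.
(* Carved out of the candidates at [j0], so that the sets are visibly decreasing; by
   [candidates_frozen] nothing is lost. *)
pose pending j := [fset y in candidates (sst pi j0) |
  (y <= x)%O && after_last (sst pi j) y]%fset.
have pendingP j y : (j0 <= j)%N -> (y \in pending j) =
    [&& y \in candidates (sst pi j), (y <= x)%O & after_last (sst pi j) y].
  move=> jj; rewrite !inE /=.
  have [yx|_] := boolP (y <= x)%O; last by rewrite !andbF.
  congr (_ && _); apply/idP/idP; first exact: candidates_mono.
  exact: candidates_frozen.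
have xpending j : (j0 <= j)%N -> x \in pending j.
  by move=> jj; rewrite pendingP // lexx xafter lock_time_candidate ?lj.
(* Without further processing, [last_processed] is constant, so the least pending stamp remains the
   next one; once decided, it stays enabled, against fairness. *)
have progress j : (j0 <= j)%N ->
    exists2 k, (j <= k)%N & exists y, step_event E (srv pi) k = Process y.
  move=> jj; apply: contrapT => noP.
  have lastj k : (j <= k)%N ->
      last_processed (sst pi k) = last_processed (sst pi j).
    move=> /subnKC <-; elim: (k - j)%N => [|n IH]; rewrite ?addn0 ?addnS //.
    rewrite last_processedS; case ee: step_event => [|q w|y v|m|b|y|y|m] //.
    by case: noP; exists (j + n)%N; [exact: leq_addr|exists y].
  have [y yp ymin] := exists_min (xpending j jj).
  move: (yp); rewrite pendingP // => /and3P[yc yx ya].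
  have [v [i /decides_decision yi]] :=
    observed_decides cpi cpi (candidates_observed yc).
  have [_ /(_ (Process y) (maxn j i.+1) isT)] := algorithm hE cpi.
  case=> [k|k]; rewrite geq_max => /andP[jk ik]; last first.
    by move=> ek; apply: noP; exists k => //; exists y.
  have jk0 := leq_trans jj jk.
  split; [by exists pi| |exact: decisions_mono ik yi|].
    split; [exact: candidates_mono jk yc|by rewrite /after_last lastj|].
    (* Candidates beyond [x] exceed [y] since [y] is at most [x]; the others are pending, where [y]
       is minimal. *)
    move=> z zc za; case: (leP z x) => [zx|/ltW]; last exact: le_trans.
    apply: ymin; rewrite pendingP // zx (candidates_frozen jk (lj _ jj)) //=.
    by rewrite /after_last -(lastj _ jk).
  by apply: le_trans (lj _ jk0); rewrite lee_fin s_time_le.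
have descent n j : (j0 <= j)%N -> (#|` pending j| <= n)%N -> False.
  elim: n j => [|n IH] j jj cardj; have [k jk [y ek]] := progress j jj.
    have := xpending j jj.
    by move: cardj; rewrite leqn0 => /eqP/cardfs0_eq ->; rewrite inE.
  have jk0 := leq_trans jj jk.
  have := guard_step k cpi; rewrite ek => gy; have yx := next_le gy (xafter k).
  have [_ [yc ya _] _ _] := gy.
  have afterjk z : after_last (sst pi k) z -> after_last (sst pi j) z.
    elim: (k) {ya gy yc jk0 ek} jk => [|i IHi]; first by rewrite leqn0 => /eqP ->.
    rewrite leq_eqVlt => /predU1P[->//|ji]; move=> /after_lastS; exact: IHi.
  apply: (IH k.+1); first exact: leqW.
  rewrite -ltnS; apply: leq_trans cardj; apply: fproper_ltn_card.
  have yN : y \notin pending k.+1.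
    by rewrite !inE /= /after_last last_processedS ek ltxx !andbF.
  rewrite fproperEneq; apply/andP; split.
    apply: contraNneq yN => ->.
    by rewrite pendingP // yx afterjk // (candidates_frozen jk) ?lj.
  by apply/fsubsetP => z; rewrite !inE /= => /and3P[-> -> /after_lastS/afterjk].
exact: (descent _ j0 (leqnn _) (leqnn _)).
Qed.

End Processing.

Lemma decision_decides pi x v j : (decisions (sst pi j)).[? x]%fmap = Some v ->
  exists2 k, (k < j)%N & decides E pi x v k.
Proof.
move=> /eqP xv; have [//|k kj [kN /eqP kv]] := first_step
  (Q := fun ps => (decisions ps.1).[? x]%fmap == Some v) _ xv.
  by rewrite fnd_fmap0.
by exists k => //; have [kv'|//] := effect_decisions kv; rewrite kv' eqxx in kN.
Qed.

Lemma process_delivers pi x j k : correct_server pi ->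
  decides E pi x true j -> step_event E (srv pi) k = Process x ->
  exists n, delivers E pi (s_client x) (s_msg x) n.
Proof.
move=> cpi dx ek; have := guard_step k cpi; rewrite ek => -[_ _ xd _].
have dt : (decisions (sst pi k)).[? x]%fmap = Some true.
  have [v vE] : exists v, (decisions (sst pi k)).[? x]%fmap = Some v.
    by case: fndP xd => // xd _; exists ((decisions (sst pi k)).[xd])%fmap.
  have [i _ di] := decision_decides vE.
  have [_ agree _ _] := consensus hE x.
  by rewrite vE (agree _ _ _ _ _ _ cpi cpi di dx).
(* The pair may have been delivered earlier through another stamp; the step that put it into
   [delivered] is the one that delivers. *)
have [||n nk [nN nd]] := @first_step (srv pi)
  (fun ps => (s_client x, s_msg x) \in delivered ps.1) k.+1.
- by [].
- by rewrite stateS ek process_delivered.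
by exists n; exact: effect_delivered nd nN.
Qed.

(** Representative validity yields the f+1 correct proposers of [True] that [lock_time_observed]
    asks for. *)
Lemma decided_delivers pi x i j : correct_server pi ->
  x \in observed (sst pi i) -> decides E pi x true j ->
  exists n, delivers E pi (s_client x) (s_msg x) n.
Proof.
move=> cpi xo dx.
have [_ _ _ /(_ pi true j cpi dx)[Q cardQ hQ]] := consensus hE x.
have [k lk] := lock_time_reached cpi cpi xo.
have [|n] := eventually_processed cpi _ lk.
  move=> n; apply: (lock_time_observed cardQ) => // q /hQ[cq [s sx _]].
  by split=> //; exists s.
exact: process_delivers cpi dx.
Qed.

(** * Clients *)

Section Client.
Variables (c : Client S) (m : Msg S) (i : nat).
Hypotheses (hc : correct_client E c) (hb : broadcasts E c m i).

Local Notation cst k := (state E (cli c) k).2.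

(** A resubmission requires an existing entry for [m], and the first entry can only come from the
    unique broadcast. *)
Lemma submission_after_broadcast k :
  step_event E (cli c) k = TobBroadcast m \/
  step_event E (cli c) k = Resubmit m ->
  (i <= k)%N.
Proof.
move=> [ek|ek]; first by rewrite (no_rebroadcast hE hc hb ek).
have := guard_step k hc; rewrite ek => -[_ [r [b' [sk _]]]].
have [||n nk [nN nd]] := @first_step (cli c)
  (fun ps => (submissions ps.2).[? m]%fmap != None) k.
- by rewrite /= fnd_fmap0.
- by rewrite sk.
have := guard_step n hc.
have := effect_submissions (cli c) (local_time E (cli c) n)
  (step_event E (cli c) n) (state E (cli c) n) m.
move=> [sn|[en|->]]; first by move: nd; rewrite stateS sn (negPf nN).
  by rewrite (no_rebroadcast hE hc hb en) ltnW.
by move=> [_ [r' [b'' [sn _]]]]; rewrite sn in nN.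
Qed.

(** Real time does not increase along the chain traced backwards: delivery, decision, a correct
    proposer of [True], the packet of the client, the broadcast. *)
Lemma delivers_after_broadcast pi k : correct_server pi ->
  delivers E pi c m k -> step_time E (cli c) i <= step_time E (srv pi) k.
Proof.
move=> cpi /effect_deliver[b _ /decision_decides[j jk dj]].
have [_ _ _ /(_ pi true j cpi dj)[Q cardQ hQ]] := consensus hE (mk_stamp c m b).
have /card_gt0P[q /hQ[cq [s ps sj]]] : (0 < #|Q|)%N.
  by apply: leq_trans cardQ; rewrite addn1.
have [es _] := proposes_true cq ps.
have [n sn ns] := received_sent hc cq es.
have ik := submission_after_broadcast (effect_send sn).
apply: le_trans (step_time_homo hc ik) _.
by apply: le_trans ns (le_trans sj (step_time_homo cpi (ltnW jk))).
Qed.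

(** [r] counts the retries and [b] is the deadline chosen at step [k]. *)
Definition submits (r k : nat) (b : R) : Prop :=
  [/\ (i <= k)%N,
      forall pi, Send (srv pi) (PMessage m b) \in outputs E (cli c) k,
      (submissions (cst k.+1)).[? m]%fmap = Some (r, b)
    & b = local_time E (cli c) k + 2 ^+ r * delay_estimate S + margin S].

Lemma broadcast_submits : exists b, submits 0 i b.
Proof.
eexists; split; [by []| | |reflexivity].
  by move=> pi; rewrite /outputs hb /= to_servers_mem.
by rewrite stateS hb /= fnd_set eqxx.
Qed.

Lemma resubmit_submits r k b : step_event E (cli c) k = Resubmit m ->
  (submissions (cst k)).[? m]%fmap = Some (r, b) -> exists b', submits r.+1 k b'.
Proof.
move=> ek sk.
have out pi : Send (srv pi) (PMessage m (local_time E (cli c) k +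
    2 ^+ r.+1 * delay_estimate S + margin S)) \in outputs E (cli c) k.
  by rewrite /outputs ek /= sk to_servers_mem.
eexists; split; [|exact: out| |reflexivity].
  by apply: submission_after_broadcast; right.
by rewrite stateS ek /= sk /= fnd_set eqxx.
Qed.

(** * The fate of a single submission *)

Section Submission.
Variables (r k : nat) (b : R).
Hypothesis sub : submits r k b.

Let x := mk_stamp c m b.

Lemma submits_observed pi : correct_server pi ->
  exists j, x \in observed (sst pi j).
Proof.
move=> cpi; have [_ /(_ pi) sk _ _] := sub.
have [j ej] := eventually_received hc cpi sk.
exists j.+1; rewrite stateS ej.
by have [] := receive_message (local_time E (srv pi) j)
  (state E (srv pi) j) c m b pi.
Qed.

Lemma submits_decided : exists v, forall pi, correct_server pi ->
  exists j, decides E pi x v j.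
Proof.
have /card_gt0P[pi0] : (0 < #|[pred pi | correct_server pi]|)%N.
  by apply: leq_trans correct_quorum; rewrite addn1.
rewrite inE => cpi0; have [j0 xo] := submits_observed cpi0.
have [v [i0 dv]] := observed_decides cpi0 cpi0 xo; exists v => pi cpi.
have [v' [i' dv']] := observed_decides cpi0 cpi xo.
have [_ agree _ _] := consensus hE x.
by exists i'; rewrite (agree _ _ _ _ _ _ cpi0 cpi dv dv').
Qed.

(** The report is never overwritten by [True]: any later packet from [pi] about this stamp stems
    from a decision of [pi], and agreement fixes its value. *)
Lemma false_reported pi j : correct_server pi -> decides E pi x false j ->
  exists n, forall n', (n <= n')%N ->
    (reports (cst n')).[? (m, b, pi)]%fmap = Some false.
Proof.
move=> cpi dj.
have sj : Send (cli c) (PDecision m b false) \in outputs E (srv pi) j.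
  by rewrite /outputs dj /= mem_seq1.
have [n en] := eventually_received cpi hc sj.
exists n.+1 => n' nn'; apply: (state_mono
  (Q := fun ps => (reports ps.2).[? (m, b, pi)]%fmap = Some false)) nn' _;
  last first.
  by rewrite stateS en receive_decision.
move=> s rs; apply: reports_kept rs _ => v es.
have [s' /effect_send[c' /(@cli_inj _ S) <- es'] _] := received_sent cpi hc es.
have [_ agree _ _] := consensus hE x.
exact: (agree _ _ _ _ _ _ cpi cpi es' dj).
Qed.

(** Besides resubmissions, only the broadcast writes this entry, and it occurs once, no later than
    step [k]. *)
Lemma submissions_kept j :
  (forall n, (k < n < j)%N -> step_event E (cli c) n <> Resubmit m) ->
  (k < j)%N -> (submissions (cst j)).[? m]%fmap = Some (r, b).
Proof.
have [ik _ sk _] := sub; elim: j => // j IH noR; rewrite ltnS leq_eqVlt.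
move=> /predU1P[<-//|kj]; rewrite stateS.
have := effect_submissions (cli c) (local_time E (cli c) j)
  (step_event E (cli c) j) (state E (cli c) j) m.
move=> [->|[en|en]]; first by apply: IH => // n /andP[kn nj]; apply: noR; lia.
  by have := no_rebroadcast hE hc hb en; lia.
by case: (noR j _ en); rewrite kj /=.
Qed.

(** If the client resubmits after step [k], the earliest such step still finds the entry [(r, b)].
    If it never did, the lasting reports of all correct servers would keep [Resubmit m] enabled,
    against fairness. *)
Lemma rejected_resubmits :
  (forall pi, correct_server pi -> exists j, decides E pi x false j) ->
  exists k' b', submits r.+1 k' b'.
Proof.
move=> dF; pose resub n :=
  `[< (k < n)%N /\ step_event E (cli c) n = Resubmit m >].
have [ex|noR] := pselect (exists n, resub n).
  case: (ex_minnP ex) => n /asboolP[kn en] nmin; exists n.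
  apply: resubmit_submits en (submissions_kept _ kn) => n' /andP[kn' nn'] en'.
  have /nmin : resub n' by apply/asboolP.
  by rewrite leqNgt nn'.
have {}noR n : (k < n)%N -> step_event E (cli c) n <> Resubmit m.
  by move=> kn en; apply: noR; exists n; apply/asboolP.
have [|pi|N rep] := @eventually_all (Server S) (fun pi n => correct_server pi ->
  forall n', (n <= n')%N -> (reports (cst n')).[? (m, b, pi)]%fmap = Some false).
- by move=> pi j n jn h cpi n' nn'; apply: h => //; exact: leq_trans jn nn'.
- have [cpi|_] := boolP (correct_server pi); last by exists 0%N.
  have [j dj] := dF _ cpi; have [n hn] := false_reported cpi dj.
  by exists n.
have [_ /(_ (Resubmit m) (maxn N k.+1) isT)] := algorithm hE hc.
case=> [n|n]; rewrite geq_max => /andP[Nn kn]; last by move=> /(noR _ kn).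
split; first by exists c.
exists r, b; split; first by apply: submissions_kept => // n' /andP[/noR].
rewrite /rejected; apply: leq_trans (_ : _ <= 4 * faults S + 1)%N _; first by lia.
apply/(leq_trans correct_quorum)/subset_leq_card/fintype.subsetP => pi.
by rewrite !inE => cpi; rewrite (rep pi cpi).
Qed.

(* Local clocks are within [Psi] of real time, so at local time [b] a server
   has received what was sent [Delta] after the submission at the latest. *)
Lemma late_proposes_true Delta Psi pi v j :
  (forall p, correct E p -> clock_synchrony E Psi p) ->
  (forall p q, correct E p -> correct E q -> delay_bound E Delta p q) ->
  Delta + 2 * Psi <= 2 ^+ r * delay_estimate S ->
  correct_server pi -> proposes E pi x v j -> v = true.
Proof.
move=> sync dl large cpi pj; apply: contraT => /negPf vF.
have [_ /(_ pi) sk _ bE] := sub.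
have late : b <= local_time E (srv pi) j.
  have [_ [[_ vE]|[]//]] := effect_propose (guard_step j cpi) pj.
  by rewrite leNgt -[b]/(s_time x) -vE vF.
have [xp _] := effect_propose (guard_step j cpi) pj.
(* Receipt of the message before step [j] would already have put [x] into [proposed]. *)
suff [n nj en] : exists2 n, (n < j)%N &
    step_event E (srv pi) n = Receive (cli c) (PMessage m b).
  case/negP: xp; apply: (proposed_mono nj); rewrite stateS en.
  by have [] := receive_message (local_time E (srv pi) n)
    (state E (srv pi) n) c m b pi.
(* The two clocks cost one [Psi] each, and the positive margin makes the inequality strict. *)
have lt : step_time E (cli c) k + Delta < step_time E (srv pi) j.
  have := (sync _ hc).2 (step_time E (cli c) k).
  have := (sync _ cpi).2 (step_time E (srv pi) j).
  rewrite -/(local_time E (srv pi) j) -/(local_time E (cli c) k) !ler_norml.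
  move=> /andP[_ +] /andP[+ _]; have := margin_gt0 S; move: late.
  by rewrite bE; lra.
apply/mem_received; have /prefixP[s ->] := dl _ _ hc cpi k j lt.
by rewrite mem_cat; apply/orP; left; apply/mem_sent; exists k.
Qed.

End Submission.

(** Otherwise every submission is rejected, so there is one for each [r]. For large [r],
    representative validity gives a correct proposer of the decided value, and that proposer can
    only have proposed [True]. *)
Lemma accepted : exists r k b, submits r k b /\
  forall pi, correct_server pi -> exists j, decides E pi (mk_stamp c m b) true j.
Proof.
apply: contrapT => noT.
have all r : exists k b, submits r k b.
  elim: r => [|r [k [b sub]]]; first by exists i; exact: broadcast_submits.
  have [[] dv] := submits_decided sub; last exact: rejected_resubmits sub dv.
  by case: noT; exists r, k, b.
have [Delta [Psi [sync dl]]] := partial_synchrony hE.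
(* An integer [n] above the quotient suffices, as [n < 2 ^ n]. The absolute value is taken because
   no sign of [Delta] is assumed. *)
have [r large] : exists r, Delta + 2 * Psi <= 2 ^+ r * delay_estimate S.
  pose t := (Delta + 2 * Psi) / delay_estimate S.
  have := archi_boundP (normr_ge0 t); set n := Num.bound _ => tn; exists n.
  rewrite -ler_pdivrMr ?delay_estimate_gt0 //.
  apply: le_trans (ler_norm _) (le_trans (ltW tn) _).
  by rewrite -natrX ler_nat ltnW // ltn_expl.
have [k [b sub]] := all r.
have [v dv] := submits_decided sub.
apply: noT; exists r, k, b; split=> // pi cpi.
have [j dj] := dv _ cpi; exists j.
have [_ _ _ /(_ pi v j cpi dj)[Q cardQ hQ]] := consensus hE (mk_stamp c m b).
have /card_gt0P[q /hQ[cq [s ps _]]] : (0 < #|Q|)%N.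
  by apply: leq_trans cardQ; rewrite addn1.
by rewrite -(late_proposes_true sub sync dl large cq ps).
Qed.

End Client.
End Execution.

Theorem theorem9 (R : realType) (S : system R) (E : execution S)
    (hE : flutter_execution E) (c : Client S) (m : Msg S) (i : nat)
    (hc : correct_client E c) (hb : broadcasts E c m i) :
  exists (pi : Server S) (j : nat),
    [/\ correct_server E pi, delivers E pi c m j
      & step_time E (cli c) i <= step_time E (srv pi) j].
Proof.
have [r [k [b [sub dT]]]] := accepted hE hc hb.
have /card_gt0P[pi] : (0 < #|[pred pi | correct_server E pi]|)%N.
  by apply: leq_trans (correct_quorum hE); rewrite addn1.
rewrite inE => cpi; have [j xo] := submits_observed hE hc sub cpi.
have [n dn] := dT _ cpi.
have [s ds] := decided_delivers hE cpi xo dn.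
exists pi, s; split=> //.
exact: (delivers_after_broadcast hE hc hb cpi ds).
Qed.
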